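(* Let $C_1,\ldots,C_N\subset\mathbb{R}^d$ be closed convex sets with nonempty intersection $C=C_1\cap\cdots\cap C_N$. Let $(\beta^{(n)})_{n\ge1}$ be a sequence in $\mathcal{B}$, $\beta^{(n)}=(\beta^{(n)}_1,\ldots,\beta^{(n)}_N)$, such that for some constant $\varepsilon>0$ $$s^{(n)}=\sum_{i=1}^N\beta_i^{(n)}\le 2-\varepsilon\qquad\text{for all } n\ge1.$$ Let $I^{(n)}=\{i:1\le i\le N,\ \beta^{(n)}_i>0\}$ be the set of active indices for $\beta^{(n)}$ and let $J^{(n)}\subset I^{(n)}$, $n\ge1$, be a sequence of subsets. Assume that there is a positive integer $p$ such that for any $k\ge1$ $$\{1,2,\ldots,N\}\subset J^{((k-1)p+1)}\cup J^{((k-1)p+2)}\cup\cdots\cup J^{(kp)}.$$ For $k\ge1$ let $$\nu_J^{(k)}=\min\{\beta_i^{(n)} : (k-1)p<n\le kp,\ i\in J^{(n)}\}.$$ Assume that $$\sum_{k=1}^\infty\nu_J^{(k)}=+\infty.$$ Then for any $x^{(0)}\in\mathbb{R}^d$ the sequence $x^{(n)}$ defined by $$x^{(n)}=Q_{\beta^{(n)}}(x^{(n-1)}),\qquad n\ge1,$$ is convergent to a point in $C$.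
   Context: For a nonempty closed convex set $D\subset\mathbb{R}^d$ (with Euclidean norm), $P_D$ is the (nearest point) projection onto $D$. The parameter set is $\mathcal{B}=\{\beta=(\beta_1,\ldots,\beta_N): \beta_i\ge 0 \text{ for all } i,\ \sum_{i=1}^N\beta_i\le 2\}$. For $\beta\in\mathcal{B}$ the operator $Q_\beta:\mathbb{R}^d\to\mathbb{R}^d$ is $Q_\beta=\mathrm{Id}-\sum_{j=1}^N\beta_j(\mathrm{Id}-P_{C_j})$, where $\mathrm{Id}$ is the identity. *)

(* Defs.v *)
From mathcomp Require Import all_boot all_order all_algebra.
From mathcomp Require Import all_classical all_reals all_analysis.

Set Implicit Arguments.
Unset Strict Implicit.
Unset Printing Implicit Defensive.

Import Order.TTheory GRing.Theory Num.Theory.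
Import numFieldNormedType.Exports.

Local Open Scope classical_set_scope.
Local Open Scope ring_scope.

(* The library norm on row vectors is the sup norm; it induces the same
   topology as [enorm], but not the same nearest points. *)
Definition enorm (R : realType) (d : nat) (u : 'rV[R]_d) : R :=
  Num.sqrt (\sum_(i < d) u 0 i ^+ 2).

Definition nearest (R : realType) (d : nat) (D : set 'rV[R]_d)
    (x y : 'rV[R]_d) : Prop :=
  D y /\ forall z, D z -> enorm (x - y) <= enorm (x - z).

(* The nearest point exists and is unique when [D] is nonempty, closed and
   convex; for other [D] the value carries no meaning. *)
Definition proj (R : realType) (d : nat) (D : set 'rV[R]_d)
    (x : 'rV[R]_d) : 'rV[R]_d :=
  xget 0 [set y | nearest D x y].

Definition param_set (R : realType) (N : nat) : set ('I_N -> R) :=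
  [set b | (forall i, 0 <= b i) /\ \sum_(i < N) b i <= 2].

Definition Qop (R : realType) (d N : nat) (C : 'I_N -> set 'rV[R]_d)
    (b : 'I_N -> R) (x : 'rV[R]_d) : 'rV[R]_d :=
  x - \sum_(j < N) b j *: (x - proj (C j) x).

Definition active (R : realType) (N : nat) (b : 'I_N -> R) : {set 'I_N} :=
  [set i | 0 < b i]%SET.

(* Block [k >= 1] consists of the indices [n] with (k-1)p < n <= kp.  The minimum
   is taken in the extended reals, so that [+oo] is the neutral element; it is
   an attained real minimum as soon as some [J n] in the block is nonempty. *)
Definition nuJ (R : realType) (N : nat) (beta : nat -> 'I_N -> R)
    (J : nat -> {set 'I_N}) (p k : nat) : \bar R :=
  \big[Order.min/+oo%E]_((k.-1 * p).+1 <= n < (k * p).+1)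
    \big[Order.min/+oo%E]_(i in J n) (beta n i)%:E.

(* Main.v *)
(* For [c] in the intersection, the obtuse-angle property of projections and
   Jensen's inequality give, with [g_j = x - P_j x],
   |Q x - c|^2 + (2 - s) sum_j beta_j |g_j|^2 <= |x - c|^2.
   Hence |x_n - c| decreases, and both eps * beta_j |g_j|^2 at any step and the
   squared displacement are bounded by multiples of the decrease of |x_n - c|^2
   over a block.  If at the start of every block some C_i were at distance at
   least delta, then nu_J^(k) would be bounded by a multiple of the decrease
   over block k, and telescoping would make the series converge.  So some iterates
   come arbitrarily close to all the C_i simultaneously; these have a cluster
   point c, it lies in every C_i, and since |x_n - c| decreases, x_n --> c. *)
Require Import Defs.
From mathcomp Require Import all_boot all_order all_algebra.
From mathcomp Require Import all_classical all_reals all_analysis.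
From mathcomp Require Import ring lra.
Set Implicit Arguments.
Unset Strict Implicit.
Unset Printing Implicit Defensive.

Import Order.TTheory GRing.Theory Num.Theory.
Import numFieldNormedType.Exports.
Local Open Scope classical_set_scope.
Local Open Scope ring_scope.

(* [proj] alone is the one exported by MathComp-Analysis. *)
Local Notation proj := Defs.proj.

(** * Euclidean inner product and squared norm on row vectors *)

Section Euclidean.
Variables (R : realType) (d : nat).
Implicit Types (u v w x y z : 'rV[R]_d).

Definition dotr u v : R := \sum_(i < d) u 0 i * v 0 i.

Definition sqn u : R := dotr u u.

Lemma enormE u : enorm u = Num.sqrt (sqn u).
Proof. by congr Num.sqrt; apply: eq_bigr => i _; rewrite expr2. Qed.

Lemma dotrC u v : dotr u v = dotr v u.
Proof. by apply: eq_bigr => i _; rewrite mulrC. Qed.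

Lemma dotrDl u v w : dotr (u + v) w = dotr u w + dotr v w.
Proof. by rewrite -big_split; apply: eq_bigr => i _; rewrite mxE mulrDl. Qed.

Lemma dotrZl a u v : dotr (a *: u) v = a * dotr u v.
Proof. by rewrite mulr_sumr; apply: eq_bigr => i _; rewrite mxE mulrA. Qed.

Lemma dotrDr u v w : dotr w (u + v) = dotr w u + dotr w v.
Proof. by rewrite dotrC dotrDl !(dotrC w). Qed.

Lemma dotrZr a u v : dotr u (a *: v) = a * dotr u v.
Proof. by rewrite dotrC dotrZl dotrC. Qed.

Lemma dotrNl u v : dotr (- u) v = - dotr u v.
Proof. by rewrite -scaleN1r dotrZl mulN1r. Qed.

Lemma dotrNr u v : dotr u (- v) = - dotr u v.
Proof. by rewrite dotrC dotrNl dotrC. Qed.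

Lemma dotr_suml (I : finType) (f : I -> 'rV[R]_d) v :
  dotr (\sum_i f i) v = \sum_i dotr (f i) v.
Proof.
rewrite exchange_big; apply: eq_bigr => j _.
by rewrite summxE mulr_suml.
Qed.

Lemma dotr_sumr (I : finType) (f : I -> 'rV[R]_d) v :
  dotr v (\sum_i f i) = \sum_i dotr v (f i).
Proof. by rewrite dotrC dotr_suml; apply: eq_bigr => i _; rewrite dotrC. Qed.

Lemma sqn_ge0 u : 0 <= sqn u.
Proof. by apply: sumr_ge0 => i _; rewrite -expr2 sqr_ge0. Qed.

Lemma sqn_coord u i : u 0 i ^+ 2 <= sqn u.
Proof.
rewrite /sqn /dotr (bigD1 i) //= -expr2 lerDl.
by apply: sumr_ge0 => j _; rewrite -expr2 sqr_ge0.
Qed.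

Lemma sqn0 : sqn 0 = 0.
Proof. by apply: big1 => i _; rewrite mxE mul0r. Qed.

Lemma sqnN u : sqn (- u) = sqn u.
Proof. by rewrite /sqn dotrNl dotrNr opprK. Qed.

Lemma sqnBC u v : sqn (u - v) = sqn (v - u).
Proof. by rewrite -sqnN opprB. Qed.

Lemma sqnD u v : sqn (u + v) = sqn u + 2 * dotr u v + sqn v.
Proof. rewrite /sqn dotrDl !dotrDr (dotrC v u); ring. Qed.

Lemma sqnB u v : sqn (u - v) = sqn u - 2 * dotr u v + sqn v.
Proof. rewrite sqnD sqnN dotrNr; ring. Qed.

Lemma sqnZ a u : sqn (a *: u) = a ^+ 2 * sqn u.
Proof. by rewrite /sqn dotrZl dotrZr mulrA expr2. Qed.

Lemma sqnD_le u v : sqn (u + v) <= 2 * sqn u + 2 * sqn v.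
Proof. have := sqn_ge0 (u - v); rewrite sqnB sqnD; lra. Qed.

Lemma sqnB_le w u v : sqn (u - v) <= 2 * sqn (u - w) + 2 * sqn (w - v).
Proof. by rewrite -[u - v](subrKA w) sqnD_le. Qed.

Lemma dotr_le u v : dotr u v <= (sqn u + sqn v) / 2.
Proof. have := sqn_ge0 (u - v); rewrite sqnB; lra. Qed.

(** Jensen's inequality with unnormalised weights: both sides become double sums over pairs, the
    right one symmetrised, and [dotr_le] compares them term by term. *)
Lemma sqn_sum_le (I : finType) (b : I -> R) (g : I -> 'rV[R]_d) :
  (forall i, 0 <= b i) ->
  sqn (\sum_i b i *: g i) <= (\sum_i b i) * \sum_i b i * sqn (g i).
Proof.
move=> b0.
have -> : (\sum_i b i) * (\sum_i b i * sqn (g i)) =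
    \sum_i \sum_j b i * b j * ((sqn (g i) + sqn (g j)) / 2).
  have E1 : (\sum_i b i) * (\sum_i b i * sqn (g i)) =
      \sum_i \sum_j b i * b j * sqn (g j).
    rewrite mulr_suml; apply: eq_bigr => i _; rewrite mulr_sumr.
    by apply: eq_bigr => j _; rewrite mulrA.
  have E2 : \sum_i \sum_j b i * b j * sqn (g j) =
      \sum_i \sum_j b i * b j * sqn (g i).
    rewrite exchange_big; apply: eq_bigr => i _; apply: eq_bigr => j _.
    by rewrite (mulrC (b j)).
  transitivity (2^-1 * (\sum_i \sum_j b i * b j * sqn (g j)
     + \sum_i \sum_j b i * b j * sqn (g i))); first by rewrite E1 -E2; lra.
  rewrite -big_split mulr_sumr; apply: eq_bigr => i _ /=.
  rewrite -big_split mulr_sumr; apply: eq_bigr => j _ /=; lra.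
rewrite /sqn dotr_suml; apply: ler_sum => i _.
rewrite dotr_sumr; apply: ler_sum => j _.
by rewrite dotrZl dotrZr mulrA ler_wpM2l ?mulr_ge0 ?dotr_le.
Qed.

(** * Comparison with the sup-norm topology, and compactness *)

Lemma sqnB_continuous x : continuous (fun z => sqn (x - z)).
Proof.
apply: continuous_big; first exact: add_continuous.
move=> i _; have h : continuous (fun y : 'rV[R]_d => (x - y) 0 i).
  rewrite (_ : (fun y => _) = (fun y => x 0 i - y 0 i)); last first.
    by apply/funext => y; rewrite !mxE.
  move=> z; apply: continuousB; first exact: cst_continuous.
  exact: coord_continuous.
by move=> z; apply: continuousM; exact: h.
Qed.

Lemma near_sqnB x (e : R) : 0 < e -> \forall z \near x, sqn (x - z) < e.
Proof.
move=> e0.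
have : sqn (x - z) @[z --> x] --> sqn (x - x) by exact: sqnB_continuous.
rewrite subrr sqn0.
move=> /cvgrPdist_lt/(_ _ e0); apply: filterS => z.
by rewrite sub0r normrN ger0_norm ?sqn_ge0.
Qed.

Lemma nbhs_sqnB x (B : set 'rV[R]_d) : nbhs x B ->
  exists2 e : R, 0 < e & forall z, sqn (x - z) < e -> B z.
Proof.
move=> /nbhs_ballP[e /= e0 eB]; exists (e ^+ 2); first exact: exprn_gt0.
move=> z zx; apply: eB; split => // i j; rewrite (ord1 i) /ball /=.
have := le_lt_trans (sqn_coord (x - z) j) zx.
rewrite !mxE -(real_normK (num_real (_ - _))).
by rewrite ltr_pXn2r ?nnegrE ?normr_ge0 ?(ltW e0).
Qed.

Lemma box_compact x r :
  compact [set z : 'rV[R]_d | forall i, z 0 i \in `[x 0 i - r, x 0 i + r]].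
Proof.
apply: (@rV_compact _ _ (fun i => `[x 0 i - r, x 0 i + r]%classic)) => i.
exact: segment_compact.
Qed.

Lemma sqnB_box x r z : sqn (x - z) <= r ->
  forall i, z 0 i \in `[x 0 i - (r + 1), x 0 i + (r + 1)].
Proof.
move=> xzr i; have := le_trans (sqn_coord (x - z) i) xzr.
have := le_trans (sqn_ge0 _) xzr.
rewrite in_itv /= !mxE; set a := x 0 i; set b := z 0 i; move=> r0 h.
apply/andP; split; nra.
Qed.

(** * Projections onto closed convex sets *)

Lemma nearest_ex (D : set 'rV[R]_d) x : closed D -> D !=set0 ->
  exists y, nearest D x y.
Proof.
move=> cD [z0 Dz0].
(* The box of this radius contains every point at least as close to [x] as [z0], so a minimiser over
   its part of [D] is one over [D]. *)
set r := sqn (x - z0) + 1.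
set A := D `&` [set z : 'rV[R]_d | forall i, z 0 i \in `[x 0 i - r, x 0 i + r]].
have cA : compact A.
  by rewrite /A setIC; apply: compact_closedI => //; exact: box_compact.
have A0 : A !=set0 by exists z0; split => //= i; exact: sqnB_box.
have [y /set_mem[Dy _] ymin] := compact_EVT_min A0 cA
  (continuous_subspaceT (@sqnB_continuous x)).
exists y; split => // z Dz; rewrite !enormE ler_sqrt ?sqn_ge0//.
have [zz0|/ltW z0z] := leP (sqn (x - z)) (sqn (x - z0)).
  by apply: ymin; apply/mem_set; split => //= i; exact: sqnB_box.
apply: le_trans z0z; apply: ymin; apply/mem_set; split => //= i.
exact: sqnB_box.
Qed.

Lemma proj_nearest (D : set 'rV[R]_d) x : closed D -> D !=set0 ->
  nearest D x (proj D x).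
Proof. by move=> cD D0; apply: xgetPex; exact: nearest_ex. Qed.

(** If the product [a] were positive, moving from [y] towards [z] by the fraction [a / (a + b)],
    with [b] the squared length of [z - y], would strictly decrease the distance to [x]. This
    fraction lies in [0, 1] and makes sense even if [b = 0]. *)
Lemma nearest_obtuse (D : set 'rV[R]_d) x y z : convex_set D ->
  nearest D x y -> D z -> dotr (x - y) (z - y) <= 0.
Proof.
move=> cvD [Dy ymin] Dz; rewrite leNgt; apply/negP => a0.
set a := dotr _ _ in a0.
have b0 := sqn_ge0 (z - y); set b := sqn _ in b0.
have t0 : 0 <= a / (a + b) by rewrite divr_ge0// ltW// ltr_wpDr.
have t1 : a / (a + b) <= 1 by rewrite ler_pdivrMr ?mul1r ?lerDl// ltr_wpDr.
have /set_mem Dw := cvD z y (Itv01 t0 t1) (mem_set Dz) (mem_set Dy).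
have := ymin _ Dw; rewrite !enormE ler_sqrt ?sqn_ge0//.
set w := conv _ _ _.
have -> : x - w = (x - y) - (a / (a + b)) *: (z - y).
  rewrite (_ : w = a / (a + b) *: z + (1 - a / (a + b)) *: y)//.
  by apply/rowP => i; rewrite !mxE; ring.
rewrite (sqnB (x - y)) sqnZ dotrZr -/a -/b; set s := sqn (x - y).
have -> : s - 2 * (a / (a + b) * a) + (a / (a + b)) ^+ 2 * b =
   s - (a ^+ 2 * (2 * a + b)) / (a + b) ^+ 2.
  by field; rewrite gt_eqF // ltr_wpDr.
rewrite lerBDr gerDl leNgt => /negP; apply.
rewrite divr_gt0 ?mulr_gt0 ?exprn_gt0//; lra.
Qed.

Lemma proj_dotr (D : set 'rV[R]_d) x c : closed D -> convex_set D -> D c ->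
  sqn (x - proj D x) <= dotr (x - proj D x) (x - c).
Proof.
move=> cD cvD Dc; have := nearest_obtuse cvD
  (proj_nearest x cD (ex_intro _ c Dc)) Dc.
set y := proj D x.
have -> : c - y = (x - y) - (x - c) by apply/rowP => i; rewrite !mxE; ring.
by rewrite dotrDr dotrNr subr_le0.
Qed.

(** * One step of the iteration *)

Section Operator.
Variables (N : nat) (C : 'I_N -> set 'rV[R]_d).
Hypothesis C_closed : forall i, closed (C i).
Hypothesis C_convex : forall i, convex_set (C i).
Variable b : 'I_N -> R.
Hypothesis b_ge0 : forall i, 0 <= b i.

(** In the expansion of the square, [proj_dotr] bounds the cross term and [sqn_sum_le] the quadratic
    one. *)
Lemma Qop_fejer c x : (\bigcap_i C i) c ->
  sqn (Qop C b x - c)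
    + (2 - \sum_i b i) * (\sum_i b i * sqn (x - proj (C i) x))
  <= sqn (x - c).
Proof.
move=> Cc; rewrite /Qop; set g := \sum_(j < N) _.
have -> : x - g - c = (x - c) - g by rewrite addrAC.
have := sqn_sum_le (fun i => x - proj (C i) x) b_ge0; rewrite -/g.
rewrite (sqnB (x - c)) dotrC {3}/g dotr_suml.
have : \sum_i b i * sqn (x - proj (C i) x) <=
    \sum_i dotr (b i *: (x - proj (C i) x)) (x - c).
  apply: ler_sum => i _; rewrite dotrZl ler_wpM2l//.
  by apply: proj_dotr => //; exact: Cc.
rewrite mulrBl; lra.
Qed.

Lemma Qop_displacement x :
  sqn (Qop C b x - x) <=
  (\sum_i b i) * \sum_i b i * sqn (x - proj (C i) x).
Proof. by rewrite /Qop addrAC subrr sub0r sqnN; exact: sqn_sum_le. Qed.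

End Operator.

(** * Cluster points and limits expressed through [sqn] *)

Lemma bounded_seq_cluster (y : nat -> 'rV[R]_d) c0 r :
  (forall n, sqn (y n - c0) <= r) ->
  exists c, forall (e : R) (m : nat), 0 < e ->
    exists2 n, (m <= n)%N & sqn (c - y n) < e.
Proof.
move=> yr.
have [|c [_ cy]] := @box_compact c0 (r + 1) (y @ \oo) _.
  by exists 0%N => // n _ /=; apply: sqnB_box; rewrite sqnBC.
exists c => e m e0.
have /cy/(_ (near_sqnB c e0)) : (y @ \oo) (y @` [set n | (m <= n)%N]).
  by exists m => // n mn /=; exists n.
by move=> [_ [[n /= mn <-] cyn]]; exists n.
Qed.

Lemma closed_sqnB (D : set 'rV[R]_d) c : closed D ->
  (forall e : R, 0 < e -> exists2 z, D z & sqn (c - z) < e) -> D c.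
Proof.
move=> cD cz; apply: cD => B /nbhs_sqnB[e e0 eB].
by have [z Dz /eB] := cz e e0; exists z.
Qed.

Lemma cvg_sqnB (y : nat -> 'rV[R]_d) c :
  (forall e : R, 0 < e ->
    exists m, forall n, (m <= n)%N -> sqn (c - y n) < e) ->
  y n @[n --> \oo] --> c.
Proof.
move=> yc B /nbhs_sqnB[e e0 eB]; have [m my] := yc e e0.
by exists m => // n /= mn; apply: eB; exact: my.
Qed.

End Euclidean.

Lemma nuJ_ge0 (R : realType) (N : nat) (beta : nat -> 'I_N -> R)
    (J : nat -> {set 'I_N}) (p k : nat) :
  (forall n, (1 <= n)%N -> forall i, 0 <= beta n i) ->
  (0 <= nuJ beta J p k)%E.
Proof.
move=> b0; rewrite /nuJ big_nat_cond le_bigmin ?leey// => n.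
move=> /andP[/andP[n0 _] _].
by rewrite le_bigmin ?leey// => i _; rewrite lee_fin b0// (leq_trans _ n0).
Qed.

Lemma nuJ_le (R : realType) (N : nat) (beta : nat -> 'I_N -> R)
    (J : nat -> {set 'I_N}) (p k n : nat) (i : 'I_N) :
  (k.-1 * p < n <= k * p)%N -> i \in J n -> (nuJ beta J p k <= (beta n i)%:E)%E.
Proof.
move=> /andP[kn nk] iJ; rewrite /nuJ.
rewrite (@bigD1_seq _ _ _ _ _ n) ?iota_uniq ?mem_index_iota ?ltnS ?kn//=.
by rewrite ge_min bigmin_le_cond.
Qed.

(** Each use of [sqnB_le] doubles the constant, whence [2 ^+ j]. The crude factor is harmless, as
    only [j] at most the block length occurs. *)
Lemma drift_le (R : realType) (d : nat) (x : nat -> 'rV[R]_d) (F : nat -> R)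
    (K : R) :
  (forall n, sqn (x n.+1 - x n) <= K * (F n - F n.+1)) ->
  forall n j, sqn (x (n + j)%N - x n) <= K * 2 ^+ j * (F n - F (n + j)%N).
Proof.
move=> xF n; elim=> [|j IH].
  by rewrite addn0 !subrr mulr0 sqn0.
rewrite addnS; apply: le_trans (sqnB_le (x (n + j)%N) _ _) _.
have step := xF (n + j)%N; have := le_trans (sqn_ge0 _) step.
have : 1 <= 2 ^+ j :> R by rewrite exprn_ege1 ?ler1n.
move: step IH; rewrite exprS.
set a := 2 ^+ j; set u := F n; set v := F _; set w := F _.
set s := sqn _; set t := sqn _ => sK IH a1 K0.
have : 0 <= (a - 1) * (K * (v - w)) by rewrite mulr_ge0 ?subr_ge0.
nra.
Qed.

Theorem theorem3 (R : realType) (d N : nat) (C : 'I_N -> set 'rV[R]_d)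
    (C_closed : forall i, closed (C i))
    (C_convex : forall i, convex_set (C i))
    (C_neq0 : \bigcap_i C i !=set0)
    (beta : nat -> 'I_N -> R)
    (beta_param : forall n, (1 <= n)%N -> @param_set R N (beta n))
    (eps : R) (eps_gt0 : 0 < eps)
    (beta_sum : forall n, (1 <= n)%N -> \sum_(i < N) beta n i <= 2 - eps)
    (J : nat -> {set 'I_N})
    (J_active : forall n, (1 <= n)%N -> J n \subset active (beta n))
    (p : nat) (p_gt0 : (0 < p)%N)
    (J_cover : forall k, (1 <= k)%N -> forall i : 'I_N,
       exists2 n, (k.-1 * p < n <= k * p)%N & i \in J n)
    (nu_sum : (\sum_(1 <= k <oo) nuJ beta J p k = +oo)%E)
    (x : nat -> 'rV[R]_d)
    (x_rec : forall n, (1 <= n)%N -> x n = Qop C (beta n) (x n.-1)) :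
  exists2 c, (\bigcap_i C i) c & x n @[n --> \oo] --> c.
Proof.
have b0 n i : (1 <= n)%N -> 0 <= beta n i by move=> /beta_param[].
(* The step from [x n] to [x n.+1] uses the weights [beta n.+1]. *)
pose a n := \sum_i beta n.+1 i * sqn (x n - proj (C i) (x n)).
have a0 n : 0 <= a n by apply: sumr_ge0 => i _; rewrite mulr_ge0 ?sqn_ge0 ?b0.
have fejer c n : (\bigcap_i C i) c ->
    eps * a n <= sqn (x n - c) - sqn (x n.+1 - c).
  move=> Cc; have := Qop_fejer C_closed C_convex (b0 n.+1 ^~ isT) (x n) Cc.
  rewrite -x_rec// -/(a n); have := a0 n; have := beta_sum n.+1 isT; nra.
have mono c n m : (\bigcap_i C i) c -> (n <= m)%N ->
    sqn (x m - c) <= sqn (x n - c).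
  move=> Cc /subnK <-; elim: (m - n)%N => // k IH; apply: le_trans IH.
  rewrite addSn -subr_ge0 (le_trans _ (fejer _ _ Cc)) ?mulr_ge0//.
  exact: ltW.
case: C_neq0 => c0 Cc0; pose F n := sqn (x n - c0).
have F0 n : 0 <= F n by exact: sqn_ge0.
have incr n : sqn (x n.+1 - x n) <= 2 / eps * (F n - F n.+1).
  have /= := Qop_displacement C (b0 n.+1 ^~ isT) (x n).
  rewrite -x_rec// -/(a n) => /le_trans; apply.
  apply: (@le_trans _ _ (2 * a n)).
    by rewrite ler_wpM2r//; have [_] := beta_param n.+1 isT.
  by rewrite -mulrA ler_wpM2l// ler_pdivlMl//; exact: fejer.
have drift := drift_le incr.
have approach (e : R) : 0 < e ->
    exists n, forall i, exists2 z, C i z & sqn (x n - z) < e.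
  move=> e0; apply: contrapT => no.
  have far n : exists i, forall z, C i z -> e <= sqn (x n - z).
    apply: contrapT => nofar; apply: no; exists n => i; apply: contrapT => noz.
    apply: nofar; exists i => z Cz; rewrite leNgt; apply/negP => lez.
    by apply: noz; exists z.
  (* With [t] the squared drift from the block start and [s] the squared distance to [C i],
     [e <= 2 * t + 2 * s]. Multiplied by [eps] and the weight, the [s] term gives 2; the [t] term
     gives 8 times the power, from the 2 here, the 2 in [incr] and the weight bound 2. *)
  pose K : R := (2 + 8 * 2 ^+ p) / (eps * e).
  have nuK k : (1 <= k)%N ->
      (nuJ beta J p k <= (K * (F (k.-1 * p)%N - F (k * p)%N))%:E)%E.
    move=> k1; have [i ifar] := far (k.-1 * p)%N.
    have [n kn iJ] := J_cover k k1 i.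
    apply: le_trans (nuJ_le beta kn iJ) _; rewrite lee_fin.
    have kE : (k * p = k.-1 * p + p)%N by rewrite -{1}(prednK k1) mulSnr.
    move: kn; rewrite kE; move: (k.-1 * p)%N ifar => q ifar /andP[qn nqp].
    (* After the shift, the active step starts at [x n] with [q <= n < q + p], so the drift is
       measured over fewer than [p] steps. *)
    case: n qn nqp iJ => // n; rewrite ltnS => qn nqp _.
    have Ciz : C i (proj (C i) (x n)).
      by have [] := proj_nearest (x n) (C_closed i) (ex_intro _ c0 (Cc0 i I)).
    have := le_trans (ifar _ Ciz) (sqnB_le (x n) _ _).
    have := drift q (n - q)%N; rewrite subnKC// (sqnBC (x n)).
    have bi0 := b0 n.+1 i isT.
    have bi2 : beta n.+1 i <= 2.
      have [_] := beta_param n.+1 isT; apply: le_trans.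
      by rewrite (bigD1 i)//= lerDl sumr_ge0// => j _; exact: b0.
    have ba : eps * (beta n.+1 i * sqn (x n - proj (C i) (x n)))
        <= F n - F n.+1.
      apply: le_trans (fejer _ _ Cc0); rewrite ler_wpM2l ?(ltW eps_gt0)//.
      rewrite /a (bigD1 i)//= lerDl sumr_ge0// => j _.
      by rewrite mulr_ge0 ?sqn_ge0 ?b0.
    have Fqn : F n <= F q by exact: mono.
    have Fnn : F n.+1 <= F n by exact: mono.
    have Fp : F (q + p)%N <= F n.+1 by exact: mono.
    have pow : 2 ^+ (n - q) <= 2 ^+ p :> R.
      by rewrite ler_weXn2l ?ler1n// leq_subLR (leq_trans _ nqp).
    move: ba; set s := sqn _; set t := sqn _.
    set u := 2 ^+ _ in pow *; set v := 2 ^+ _ in pow *.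
    set b := beta _ _ in bi0 bi2 *.
    move=> ba tle est.
    rewrite /K mulrAC ler_pdivlMr ?mulr_gt0// -/v.
    have tle' : eps * t <= 2 * v * (F q - F n).
      apply: (@le_trans _ _ (2 * u * (F q - F n))).
        by rewrite -ler_pdivlMl// !mulrA (mulrC _ 2).
      by rewrite ler_wpM2r ?subr_ge0// ler_wpM2l.
    have v0 : 0 <= v by rewrite exprn_ge0.
    have est1 : b * (eps * e) <= eps * b * (2 * t + 2 * s).
      by rewrite mulrA (mulrC b) ler_wpM2l ?mulr_ge0// ltW.
    have est2 : b * (eps * t) <= 2 * (2 * v * (F q - F n)).
      apply: ler_pM => //; rewrite mulr_ge0 ?sqn_ge0 ?ltW//.
    apply: le_trans est1 _.
    have : 0 <= v * (F n - F (q + p)%N).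
      by rewrite mulr_ge0// subr_ge0 (le_trans Fp).
    lra.
  (* The bounds [nuK] telescope over the blocks, contradicting the divergence of the series. *)
  suff : (\sum_(1 <= k <oo) nuJ beta J p k <= (K * F 0%N)%:E)%E.
    by rewrite nu_sum leye_eq.
  have K0 : 0 <= K.
    by rewrite divr_ge0 ?addr_ge0 ?mulr_ge0 ?exprn_ge0 ?(ltW e0) ?(ltW eps_gt0).
  apply: lime_le.
    by apply: is_cvg_nneseries => k _ _; apply: nuJ_ge0 => n n1 i; exact: b0.
  apply: nearW => m.
  have : forall n, (\sum_(1 <= k < n.+1) nuJ beta J p k <=
      (K * (F 0%N - F (n * p)%N))%:E)%E.
    elim=> [|n IH]; first by rewrite big_geq// mul0n subrr mulr0.
    rewrite big_nat_recr//=; apply: le_trans (leeD IH (nuK n.+1 isT)) _.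
    by rewrite -EFinD lee_fin -mulrDr addrA subrK.
  case: m => [|m /(_ m)/le_trans]; first by rewrite big_geq// lee_fin mulr_ge0.
  by apply; rewrite lee_fin ler_wpM2l// gerBl.
have gap m : 0 < m.+1%:R^-1 :> R by rewrite invr_gt0.
have [n nP] := choice (fun m => approach _ (gap m)).
(* The iterates [x (n k)] stay bounded by monotonicity around [c0]. Arbitrarily late [k] are
   required so that their distances to the sets also become small. *)
have [c cP] : exists c, forall (e : R) (m : nat), 0 < e ->
    exists2 k, (m <= k)%N & sqn (c - x (n k)) < e.
  by apply: (@bounded_seq_cluster _ _ _ c0 (F 0%N)) => k; exact: mono.
have Cc : (\bigcap_i C i) c.
  move=> i _; apply: closed_sqnB => // e e0.
  (* [sqnB_le] doubles each of the two squared distances, so a quarter of [e] suffices for each. *)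
  have e4 : 0 < e / 4 by rewrite divr_gt0.
  have [m me] : exists m : nat, m.+1%:R^-1 < e / 4.
    have [m _ /(_ m (leqnn m))] := near_infty_natSinv_lt (PosNum e4).
    by exists m.
  have [k mk ck] := cP _ m e4.
  have [z Cz xz] := nP k i; exists z => //.
  have km : k.+1%:R^-1 <= m.+1%:R^-1 :> R by rewrite lef_pV2 ?posrE// ler_nat.
  have {}xz := lt_trans (lt_le_trans xz km) me.
  have := sqnB_le (x (n k)) c z; lra.
(* Now that [c] lies in the intersection, [mono] applies around [c]: one close iterate keeps all
   later ones close. *)
exists c => //; apply: cvg_sqnB => e e0.
have [k _ ck] := cP e 0%N e0; exists (n k) => m km.
by rewrite sqnBC (le_lt_trans (mono _ _ _ Cc km))// sqnBC.
Qed.
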